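(* Consider ${\rm CHC}_D(\mathbf k,\mathbf n,\lambda)$ under regime (A1) and the test $\psi^s=\psi_{sum}\vee\psi_{scan}$ with threshold $W\to\infty$. If either (i) $\dfrac{\lambda\prod_ik_i}{\sqrt{\prod_in_i}}\to\infty$ and $W\le c\,\lambda\dfrac{\prod_ik_i}{\sqrt{\prod_in_i}}$ for some fixed $0<c<1$; or (ii) $\liminf\dfrac{\lambda(\prod_ik_i)^{1/2}}{\sqrt{2\sum_{i=1}^dk_i\log(n_i/k_i)}}>1$, then the risk $\mathbb P_0(\psi^s=1)+\sup_{\mathcal X\in\mathscr X_{\rm CHC}(\mathbf k,\mathbf n,\lambda)}\mathbb P_{\mathcal X}(\psi^s=0)\to0$. Under regime (A2) (with a suitable choice of $W$), $\psi^s$ achieves reliable detection when $\beta<(d\alpha-d/2)\vee((d-1)\alpha/2)$.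
   Context: Model: $\mathcal Y=\mathcal X+\mathcal Z\in\mathbb R^{n_1\times\cdots\times n_d}$, $\mathcal Z$ i.i.d. $N(0,1)$; ${\rm CHC}_D$ tests $H_0:\mathcal X=0$ vs $H_1:\mathcal X\in\mathscr X_{\rm CHC}(\mathbf k,\mathbf n,\lambda)=\{\lambda'\mathbf 1_{I_1}\circ\cdots\circ\mathbf 1_{I_d}:|I_i|=k_i,\lambda'\ge\lambda\}$. Sum test: $\psi_{sum}=\mathbf 1\big(\sum_{i_1,\dots,i_d}\mathcal Y_{[i_1,\dots,i_d]}/\sqrt{n_1\cdots n_d}>W\big)$. Scan test: $\psi_{scan}=\mathbf 1\big(T_{scan}>\sqrt{2\log G}\big)$ with $G=\prod_{i=1}^d\binom{n_i}{k_i}$ and $T_{scan}=\max_{C}\sum_{(i_1,\dots,i_d)\in C}\mathcal Y_{[i_1,\dots,i_d]}/\sqrt{k_1\cdots k_d}$, the maximum over all $C=I_1\times\cdots\times I_d$ with $I_i\subseteq[n_i]$, $|I_i|=k_i$. Regime (A1): $n_i\to\infty,k_i\to\infty,k_i/n_i\to0$ for all $i$. Regime (A2): fixed $\alpha\in[0,1],\beta\in\mathbb R$; $n\to\infty$, $n_i$ with $\log n_i/\log n\to1$, $k_i=k$ with $\log k/\log n\to\alpha$, $\log(1/\lambda)/\log n\to\beta$.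
   Formalization: In regime (A2) the theorem assumes λ>0 and 1≤k<n_i for every i; if k=n_i for all i (possible when α=1), then G=1, the scan threshold is 0 and the scan test rejects under H_0 with probability 1/2, so the claim fails. Clusters filling only some modes are excluded too. *)

(* Defs.v *)
From HB Require Import structures.
From mathcomp Require Import all_boot all_order all_algebra.
From mathcomp Require Import all_classical all_reals all_analysis.
Set Implicit Arguments. Unset Strict Implicit. Unset Printing Implicit Defensive.
Import Order.TTheory GRing.Theory Num.Theory.
Import numFieldNormedType.Exports.
Local Open Scope classical_set_scope.
Local Open Scope ring_scope.

Section CHC.
Context {R : realType}.

Definition tidx (d : nat) (n : 'I_d -> nat) : finType :=
  {dffun forall i : 'I_d, 'I_(n i)}.

(* a cluster I_1 x ... x I_d, given by its d "sides" *)
Definition tsides (d : nat) (n : 'I_d -> nat) : finType :=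
  {dffun forall i : 'I_d, {set 'I_(n i)}}.

Definition admissible d (n k : 'I_d -> nat) (S : tsides n) : bool :=
  [forall i, #|S i| == k i].

Definition in_cluster d (n : 'I_d -> nat) (S : tsides n) (x : tidx n) : bool :=
  [forall i, x i \in S i].

Definition cluster_tensor d (n : 'I_d -> nat) (lam : R) (S : tsides n) :
  tidx n -> R := fun x => if in_cluster S x then lam else 0.

Definition psi_sum d (n : 'I_d -> nat) (W : R) (Y : tidx n -> R) : bool :=
  (\sum_(x : tidx n) Y x) / Num.sqrt ((\prod_(i < d) n i)%:R) > W.

Definition Gcount d (n k : 'I_d -> nat) : nat := \prod_(i < d) 'C(n i, k i).

(* T_scan, as an extended real (max over the empty family is -oo) *)
Definition T_scan d (n k : 'I_d -> nat) (Y : tidx n -> R) : \bar R :=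
  \big[Order.max/-oo%E]_(S : tsides n | admissible k S)
     ((\sum_(x : tidx n | in_cluster S x) Y x)
        / Num.sqrt ((\prod_(i < d) k i)%:R))%:E.

Definition psi_scan d (n k : 'I_d -> nat) (Y : tidx n -> R) : bool :=
  ((Num.sqrt (2 * ln (Gcount n k)%:R))%:E < T_scan k Y)%E.

Definition psi_s d (n k : 'I_d -> nat) (W : R) (Y : tidx n -> R) : bool :=
  psi_sum W Y || psi_scan k Y.

Definition std_gaussian_iid dT (T : measurableType dT) (P : probability T R)
    (I : finType) (Z : I -> {RV P >-> R}) : Prop :=
  (forall j B, measurable B -> P (Z j @^-1` B) = normal_prob 0 1 B) /\
  (forall B : I -> set R, (forall j, measurable (B j)) ->
     P (\bigcap_(j in [set: I]) (Z j @^-1` B j)) =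
     (\prod_(j : I) P (Z j @^-1` B j))%E).

Definition risk dT (T : measurableType dT) (P : probability T R)
    d (n k : 'I_d -> nat) (lam W : R) (Z : tidx n -> {RV P >-> R}) : \bar R :=
  (P [set w | psi_s k W (fun x => Z x w)] +
   ereal_sup [set p | exists (lam' : R) (S : tsides n),
                [/\ (lam <= lam')%R, admissible k S &
                 p = P [set w | ~~ psi_s k W
                        (fun x => (cluster_tensor lam' S x + Z x w)%R)]]])%E.

End CHC.

(* Main.v *)
Require Import Defs.
From HB Require Import structures.
From mathcomp Require Import all_boot all_order all_algebra.
From mathcomp Require Import all_classical all_reals all_analysis.
From mathcomp Require Import measurable_realfun normal_distribution ring lra.
Import Order.TTheory GRing.Theory Num.Theory.
Import numFieldNormedType.Exports.
Local Open Scope classical_set_scope.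
Local Open Scope ring_scope.

(** Both test statistics are normalised sums of i.i.d. standard normal variables, shifted under the
    alternative by lam' K / sqrt N (sum test) and lam' sqrt K (scan statistic of the true cluster),
    with K = prod k_i and N = prod n_i.  The normal tail bound P(|xi| > a) <= 2 exp(-a^2/2) / a
    gives, with g = sqrt(2 log G),
      risk <= 1/W + 1/g + min(1 / (lam K / sqrt N - W), 1 / (lam sqrt K - g)),
    where the term 1/g comes from a union bound over the G clusters, as G exp(-g^2/2) = 1.  Each
    regime then reduces to showing that W, g and one of the two gaps tend to infinity, using
    log C(n,k) <= k log(n/k) + k for the scan threshold. *)

Set Implicit Arguments. Unset Strict Implicit. Unset Printing Implicit Defensive.

(** * Normal distributions *)

Section normal.
Local Open Scope charge_scope.
Context {R : realType}.
Notation mu := (@lebesgue_measure R).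

(** A named translation, so that the measurable-function structure declared below can attach to
    it. *)
Definition addr_fun (a : R) : measurableTypeR R -> measurableTypeR R := fun x => x + a.

Lemma measurable_addr_fun (a : R) : measurable_fun setT (addr_fun a).
Proof. by apply: measurable_funD => //; exact: measurable_cst. Qed.

HB.instance Definition _ a := isMeasurableFun.Build _ _ _ _ _ (measurable_addr_fun a).

(** The pushforward agrees with [mu] on half-open intervals, and this determines Lebesgue
    measure. *)
Lemma lebesgue_measure_addr (a : R) (A : set R) : measurable A ->
  pushforward mu (addr_fun a) A = mu A.
Proof.
move=> mA; apply/esym/lebesgue_measure_unique => //= _ [[u v]] _ <-.
rewrite /= /pushforward.
have -> : addr_fun a @^-1` `]u, v]%classic = `](u - a), (v - a)]%classic.
  by apply/seteqP; split => x /=; rewrite /addr_fun !in_itv/= ltrBlDr lerBrDr.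
rewrite !lebesgue_measure_itv/= !lte_fin ltrD2r.
by case: ifP => // _; congr EFin; rewrite opprB addrA subrK.
Qed.

Lemma ge0_integral_lebesgue_addr (a : R) (C : set R) (f : R -> \bar R) :
  measurable C -> measurable_fun C f -> (forall x, 0 <= f x)%E ->
  (\int[mu]_(z in C) f z = \int[mu]_(y in addr_fun a @^-1` C) (f \o addr_fun a) y)%E.
Proof.
move=> mC mf f0.
have <- := ge0_integral_pushforward (measurable_addr_fun a) mu mC mf (fun y _ => f0 y).
by apply: eq_measure_integral => //= A mA AS; exact/esym/lebesgue_measure_addr.
Qed.

(** The substitution y + x turns the density centred at m + x into the one centred at m. *)
Lemma normal_prob_addr (m s x : R) (C : set R) : s != 0 -> measurable C ->
  normal_prob m s ((fun y => x + y) @^-1` C) = normal_prob (m + x) s C.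
Proof.
move=> s0 mC.
have mf : measurable_fun C (EFin \o normal_pdf (m + x) s).
  by apply/measurable_EFinP/measurable_funTS; exact: measurable_normal_pdf.
have f0 y : (0 <= (EFin \o normal_pdf (m + x) s) y)%E by rewrite lee_fin normal_pdf_ge0.
rewrite /normal_prob [RHS](ge0_integral_lebesgue_addr x mC mf f0).
have -> : (fun y => x + y) = addr_fun x by apply/funext => y; rewrite addrC.
apply: eq_integral => y _ /=; congr EFin.
have E : y + x - (m + x) = y - m by rewrite opprD addrACA subrr addr0.
by rewrite !normal_pdfE// /normal_fun /addr_fun E.
Qed.

(** The Radon-Nikodym derivative with respect to [mu] equals the density almost everywhere, because
    both have the same integral over every measurable set. Nonnegativity and the finite integral
    give the integrability that the change of variables asks for. *)
Lemma integral_normal_prob (m s : R) (f : R -> \bar R) : (forall x, 0 <= f x)%E ->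
  measurable_fun setT f -> (\int[normal_prob m s]_x f x < +oo)%E ->
  (\int[normal_prob m s]_x f x = \int[mu]_x (f x * (normal_pdf m s x)%:E))%E.
Proof.
move=> f0 mf finf.
rewrite -(Radon_Nikodym_change_of_variables (normal_prob_dominates m s))//=; last first.
  apply/integrableP; split => //.
  by under eq_integral do rewrite gee0_abs//.
have mRN : mu.-integrable [set: R] ('d (charge_of_finite_measure (normal_prob m s)) '/d mu).
  by apply: Radon_Nikodym_integrable; exact: normal_prob_dominates.
apply: ae_eq_integral => //.
- by apply: emeasurable_funM => //; exact: measurable_int mRN.
- apply: emeasurable_funM => //=; apply/measurableT_comp => //=.
  exact: measurable_normal_pdf.
apply: ae_eqe_mul2l => /=.
apply: integral_ae_eq => //.
  by apply/measurable_EFinP; exact: measurable_normal_pdf.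
move=> E _ mE.
rewrite -Radon_Nikodym_integral//; exact: normal_prob_dominates.
Qed.


Lemma normal_peakE (s : R) : normal_peak s = (`|s| * Num.sqrt (pi *+ 2))^-1.
Proof. by rewrite /normal_peak -mulrnAr sqrtrM ?sqr_ge0// sqrtr_sqr. Qed.

(** Completing the square. For independent centred normals X and Y with deviations s1 and s2, both
    sides are the joint density of (X, X + Y) at (x, z); the last factor is the conditional density
    of X given X + Y = z. *)
Lemma normal_pdfM (s1 s2 s x z : R) : s1 != 0 -> s2 != 0 -> s != 0 ->
  s ^+ 2 = s1 ^+ 2 + s2 ^+ 2 ->
  normal_pdf x s2 z * normal_pdf 0 s1 x =
  normal_pdf 0 s z * normal_pdf (z * s1 ^+ 2 / s ^+ 2) (s1 * s2 / s) x.
Proof.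
move=> s10 s20 s0 sE.
have t0 : s1 * s2 / s != 0 by rewrite !mulf_neq0// invr_neq0.
rewrite !normal_pdfE// !normal_peakE /normal_fun.
rewrite mulrACA [RHS]mulrACA -!expRD.
have p0 : Num.sqrt (pi *+ 2) != 0 :> R.
  by rewrite sqrtr_eq0 -ltNge pmulrn_lgt0// pi_gt0.
apply: (f_equal2 *%R); last apply: (f_equal expR).
  move: p0; rewrite !normrM normfV; move: (Num.sqrt _) => p p0.
  by field; rewrite p0 !normr_eq0 s0 s10 s20.
have s2sum : s1 ^+ 2 + s2 ^+ 2 != 0 by rewrite -sE expf_neq0.
rewrite !expr_div_n sE.
by field; rewrite s10 s20 s2sum.
Qed.

Lemma measurable_normal_pdf_pair (s : R) : s != 0 ->
  measurable_fun [set: measurableTypeR R * measurableTypeR R]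
    (fun p => normal_pdf p.1 s p.2).
Proof.
move=> s0.
have -> : (fun p : R * R => normal_pdf p.1 s p.2) =
    (fun x => normal_pdf 0 s x) \o (fun p => p.2 - p.1).
  by apply/funext => p /=; rewrite !normal_pdfE// /normal_fun subr0.
apply: measurableT_comp; first exact: measurable_normal_pdf.
by apply: measurable_funB; [exact: measurable_snd|exact: measurable_fst].
Qed.

(** The left side is the law of a sum of two independent centred normals, conditioned on the first.
    Tonelli moves the integral over x inside, where it is the total mass of a conditional
    density. *)
Lemma normal_prob_convolution (s1 s2 s : R) (C : set R) :
  s1 != 0 -> s2 != 0 -> s != 0 -> s ^+ 2 = s1 ^+ 2 + s2 ^+ 2 -> measurable C ->
  (\int[normal_prob 0 s1]_x normal_prob 0 s2 ((fun y => x + y)%R @^-1` C) =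
   normal_prob 0 s C)%E.
Proof.
move=> s10 s20 s0 sE mC.
under eq_integral do rewrite normal_prob_addr// add0r.
pose f (p : measurableTypeR R * measurableTypeR R) : \bar R :=
  (normal_pdf p.1 s2 p.2 * \1_C p.2)%:E.
have mf : measurable_fun setT f.
  apply/measurable_EFinP/measurable_funM; first exact: measurable_normal_pdf_pair.
  apply: measurableT_comp; last exact: measurable_snd.
  exact: measurable_indic.
have f0 p : (0 <= f p)%E by rewrite lee_fin mulr_ge0// normal_pdf_ge0.
(* As a section integral of [f], the inner probability is measurable in x by Tonelli. *)
have NE x : (normal_prob x s2 C = \int[mu]_y f (x, y))%E.
  rewrite /normal_prob integral_mkcond; apply: eq_integral => y _.
  rewrite /f /= patchE indicE; case: ifP => yC.
    by rewrite mulr1.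
  by rewrite mulr0.
rewrite integral_normal_prob//; last 2 first.
- under eq_fun do rewrite NE.
  exact: (measurable_fun_fubini_tonelli_F (m2 := mu)).
- apply: (@le_lt_trans _ _ (\int[normal_prob 0 s1]_x 1)%E); last first.
    by rewrite integral_cst// mul1e (le_lt_trans (probability_le1 _ _))// ltry.
  apply: ge0_le_integral => //.
  + under eq_fun do rewrite NE.
    exact: (measurable_fun_fubini_tonelli_F (m2 := mu)).
  + by move=> x _; exact: probability_le1.
pose g (p : measurableTypeR R * measurableTypeR R) : \bar R :=
  (f p * (normal_pdf 0 s1 p.1)%:E)%E.
have mg : measurable_fun setT g.
  apply: emeasurable_funM => //; apply/measurable_EFinP.
  by apply: measurableT_comp; [exact: measurable_normal_pdf|exact: measurable_fst].
have g0 p : (0 <= g p)%E by rewrite mule_ge0// lee_fin normal_pdf_ge0.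
transitivity (\int[mu]_x \int[mu]_y g (x, y))%E.
  apply: eq_integral => x _; rewrite NE -ge0_integralZr//.
  - by apply: measurableT_comp => //; exact: measurable_pair1.
  - by rewrite lee_fin normal_pdf_ge0.
rewrite (fubini_tonelli (m1 := mu) (m2 := mu))// /normal_prob [RHS]integral_mkcond.
apply: eq_integral => z _.
(* By [normal_pdfM] the integrand is a factor depending on z alone times a normal density in x,
   which integrates to one. *)
transitivity (\int[mu]_x ((\1_C z * normal_pdf 0 s z)%:E *
   (normal_pdf (z * s1 ^+ 2 / s ^+ 2) (s1 * s2 / s) x)%:E))%E.
  apply: eq_integral => x _; rewrite /g /f /= -!EFinM; congr EFin.
  rewrite mulrAC (@normal_pdfM s1 s2 s)//; ring.
rewrite ge0_integralZl//=; first last.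
- by rewrite lee_fin mulr_ge0// normal_pdf_ge0.
- by move=> x _; rewrite lee_fin normal_pdf_ge0.
- by apply/measurable_EFinP; exact: measurable_normal_pdf.
rewrite integral_normal_pdf mule1 patchE indicE.
by case: ifP => _; rewrite ?mul1r ?mul0r.
Qed.

(** Supplies the explicit antiderivative of x exp(-x^2 / (2 s^2)) for the tail bound. *)
Lemma normal_fun_scale_derivative (c s x : R) : s != 0 ->
  is_derive x 1 (fun y => - (c * s ^+ 2 * normal_fun 0 s y)) (c * x * normal_fun 0 s x).
Proof.
move=> s0; rewrite /normal_fun.
have H : is_derive x (1 : R) (fun y : R => - (y - 0) ^+ 2 / (s ^+ 2 *+ 2)) (- x / s ^+ 2).
  have -> : (fun y : R => - (y - 0) ^+ 2 / (s ^+ 2 *+ 2)) =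
      (- (s ^+ 2 *+ 2)^-1) *: (fun y : R => y ^+ 2).
    by apply/funext => y /=; rewrite subr0 !fctE /GRing.scale/= mulNr mulNr mulrC.
  apply: is_derive_eq.
  rewrite /GRing.scale/= -mulr_natr; field.
  exact: s0.
apply: is_derive_eq.
rewrite /GRing.scale/=.
by field.
Qed.

Lemma cvg_normal_fun_pinfty (m s : R) : s != 0 -> normal_fun m s x @[x --> +oo] --> 0.
Proof.
move=> s0.
have D0 : 0 < s ^+ 2 *+ 2 by rewrite pmulrn_lgt0// exprn_even_gt0.
have -> : normal_fun m s =
    (fun y => expR (- y)) \o (fun x => (x - m) ^+ 2 / (s ^+ 2 *+ 2)).
  by apply/funext => x /=; rewrite /normal_fun mulNr.
apply: (@cvg_comp _ _ _ (fun x => (x - m) ^+ 2 / (s ^+ 2 *+ 2)) (fun y => expR (- y)) _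
  (pinfty_nbhs R)); last exact: cvgr_expR.
apply/cvgryPge => A; near=> x.
rewrite ler_pdivlMr//; set B := A * _.
(* Then x - m >= 1 + |B|, and the square of the right side is at least B. *)
have x1 : m + 1 + `|B| <= x by near: x; apply: nbhs_pinfty_ge; rewrite num_real.
by have := ler_norm B; have := normr_ge0 B; nra.
Unshelve. all: by end_near. Qed.

(* On [x >= a s] the density is at most [x / (a s)] times itself, which has an explicit antiderivative. *)
Lemma normal_prob_right_tail (s a : R) : 0 < s -> 0 < a ->
  (normal_prob 0 s `[(a * s)%R, +oo[ <= (expR (- (a ^+ 2 / 2)) / a)%:E)%E.
Proof.
move=> s0 a0; have sN0 : s != 0 by rewrite gt_eqF.
set c := normal_peak s / (a * s).
pose F (y : R) := - (c * s ^+ 2 * normal_fun 0 s y).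
pose f (x : R) := c * x * normal_fun 0 s x.
have c0 : 0 < c by rewrite divr_gt0 ?mulr_gt0// normal_peak_gt0.
have dF (x : R) : is_derive x (1 : R) F (f x) by exact: normal_fun_scale_derivative.
have cf : continuous f.
  move=> x; apply: cvgM.
    by apply: cvgM; [exact: cvg_cst|exact: cvg_id].
  have -> : normal_fun 0 s = (fun x => (normal_peak s)^-1 * normal_pdf 0 s x).
    by apply/funext => y; rewrite normal_pdfE// mulKf// gt_eqF// normal_peak_gt0.
  by apply: cvgM; [exact: cvg_cst|exact: continuous_normal_pdf].
have FE : (\int[mu]_(x in `[(a * s)%R, +oo[) (f x)%:E = 0%:E - (F (a * s)%R)%:E)%E.
  apply: ge0_continuous_FTC2y.
  - move=> x ax; rewrite /f mulr_ge0 ?expR_ge0// mulr_ge0 ?(ltW c0)//.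
    by apply: le_trans ax; rewrite mulr_ge0 ?ltW.
  - exact: continuous_subspaceT.
  - rewrite -oppr0; apply: cvgN.
    rewrite -(mulr0 (c * s ^+ 2)); apply: cvgM; first exact: cvg_cst.
    exact: cvg_normal_fun_pinfty.
  - by move=> x _; have [] := dF x.
  - apply: cvg_at_right_filter.
    have : {for (a * s), continuous F}; last by [].
    by apply: differentiable_continuous; apply/derivable1_diffP; have [] := dF (a * s).
  - by move=> x _; rewrite derive1E; have [_ ->] := dF x.
apply: (@le_trans _ _ (\int[mu]_(x in `[(a * s)%R, +oo[) (f x)%:E)%E).
  apply: ge0_le_integral => //.
  - by move=> x _; rewrite lee_fin normal_pdf_ge0.
  - by apply/measurable_EFinP/measurable_funTS; exact: measurable_normal_pdf.
  - by apply/measurable_EFinP; apply: measurable_funTS; exact: continuous_measurable_fun cf.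
  - move=> x /=; rewrite in_itv/= andbT => ax.
    rewrite lee_fin normal_pdfE// /f ler_wpM2r ?normal_fun_ge0//.
    rewrite /c mulrAC ler_pdivlMr ?mulr_gt0// ler_wpM2l//.
    by rewrite normal_peak_ge0.
rewrite FE -EFinB sub0r opprK lee_fin.
have -> : normal_fun 0 s (a * s) = expR (- (a ^+ 2 / 2)).
  by rewrite /normal_fun subr0; congr expR; rewrite -mulr_natr; field.
rewrite [leRHS]mulrC ler_wpM2r ?expR_ge0//.
have -> : c * s ^+ 2 = (normal_peak s * s) / a.
  by rewrite /c; field; rewrite sN0 gt_eqF.
rewrite ler_piMl ?invr_ge0 ?(ltW a0)//.
(* What remains is that the peak times s, that is 1 / sqrt(2 pi), is at most 1; [pi_ge2]
   suffices. *)
rewrite /normal_peak mulrC ler_pdivrMr ?sqrtr_gt0 ?pmulrn_lgt0 ?mulr_gt0 ?pi_gt0 ?exprn_gt0//.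
rewrite mul1r -[leLHS]ger0_norm ?(ltW s0)// -sqrtr_sqr ler_wsqrtr//.
rewrite -mulrnAr ler_peMr ?sqr_ge0//.
have := @pi_ge2 R; rewrite -mulr_natr; lra.
Qed.

(** The reflection x -> -x preserves the centred density and reduces this to the right tail. *)
Lemma normal_prob_left_tail (s a : R) : 0 < s -> 0 < a ->
  (normal_prob 0 s `]-oo, (- (a * s))%R] <= (expR (- (a ^+ 2 / 2)) / a)%:E)%E.
Proof.
move=> s0 a0; have sN0 : s != 0 by rewrite gt_eqF.
rewrite /normal_prob ge0_integration_by_substitutionNy.
- apply: le_trans (normal_prob_right_tail s0 a0).
  rewrite /normal_prob le_eqVlt; apply/orP; left; apply/eqP.
  apply: eq_integral => x _ /=.
  by rewrite !normal_pdfE// /normal_fun !subr0 sqrrN.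
- by apply: continuous_subspaceT; exact: continuous_normal_pdf.
- by move=> x _; exact: normal_pdf_ge0.
Qed.

End normal.

(** * Sums of i.i.d. standard normal variables *)

Section gaussian_sums.
Context {R : realType} d (T : measurableType d) (P : probability T R).

Lemma measurable_bool_set (b : T -> bool) : measurable_fun setT b -> measurable [set w | b w].
Proof.
move=> mb; rewrite -[X in measurable X]setTI.
by have -> : [set w | b w] = b @^-1` [set true] by []; exact: mb.
Qed.

(* [E] carries the constraints on the variables not yet summed, so that the lemma can be iterated
   without extending independence from rectangles to generated sigma-algebras. *)
Lemma normal_sum_indep (X Y : T -> R) (E : set T) (s1 s2 s : R) :
  s1 != 0 -> s2 != 0 -> s != 0 -> s ^+ 2 = s1 ^+ 2 + s2 ^+ 2 ->
  measurable_fun setT X -> measurable_fun setT Y -> measurable E ->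
  (forall A B, measurable A -> measurable B ->
    P (X @^-1` A `&` Y @^-1` B `&` E) = (normal_prob 0%R s1 A * normal_prob 0%R s2 B * P E)%E) ->
  forall C, measurable C ->
    P ((X \+ Y) @^-1` C `&` E) = (normal_prob 0%R s C * P E)%E.
Proof.
move=> s10 s20 s0 sE mX mY mE indep C mC.
have mXY : measurable ((X \+ Y) @^-1` C).
  by rewrite -[X in measurable X]setTI; apply: (measurable_funD mX mY).
(* The null event is treated apart, since the main argument divides by P(E). *)
have [PE0|PE0] := eqVneq (P E) 0%E.
  rewrite PE0 mule0; apply/eqP; rewrite eq_le measure_ge0 andbT -PE0.
  by apply: le_measure; rewrite ?inE//; exact: measurableI.
have PEf : P E \is a fin_num by rewrite fin_num_measure.
have mXYp : measurable_fun setT (fun w => (X w, Y w) : measurableTypeR R * measurableTypeR R).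
  by apply: measurable_fun_pair.
have k0 : 0 <= (fine (P E))^-1 by rewrite invr_ge0 fine_ge0.
pose h := fun w => (X w, Y w) : measurableTypeR R * measurableTypeR R.
(* The law of (X, Y) conditioned on [E]. By [indep] it agrees with the product of the two normal
   laws on rectangles, hence everywhere. *)
pose m' := mscale (NngNum k0) (measure_function_pushforward__canonical__measure_function_Measure (mrestr P mE) mXYp).

pose D : set (measurableTypeR R * measurableTypeR R) := [set p | C (p.1 + p.2)].
have mD : measurable D.
  rewrite -[X in measurable X]setTI.
  have : measurable_fun [set: measurableTypeR R * measurableTypeR R]
    (fun p => p.1 + p.2 : R).
    by apply: measurable_funD; [exact: measurable_fst|exact: measurable_snd].
  by apply.
have kE : ((fine (P E))^-1%:E * P E = 1)%E.
  by rewrite -[in X in (_ * X)%E](fineK PEf) -EFinM mulVf// fine_eq0.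
have H := @product_measure_unique _ _ _ _ R (normal_prob 0 s1) (normal_prob 0 s2) m'.
have PE : P ((X \+ Y) @^-1` C `&` E) = (P E * m' D)%E.
  by rewrite /m' /mscale/= /pushforward /mrestr muleA (muleC (P E)) kE mul1e.
have RE : (normal_prob 0 s1 \x normal_prob 0 s2)%E D = m' D.
  apply: H => // A B mA mB; rewrite /m' /mscale/= /pushforward /mrestr.
  transitivity ((fine (P E))^-1%:E * P (X @^-1` A `&` Y @^-1` B `&` E))%E => //.
  by rewrite indep// muleCA kE mule1.
rewrite PE muleC -RE -(normal_prob_convolution s10 s20 s0 sE mC); congr (_ * _)%E.
rewrite /product_measure1; apply: eq_integral => x _ /=; congr (normal_prob _ _ _).
by apply/seteqP; split => y; rewrite /xsection /D /= inE.
Qed.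


Variables (J : finType) (Z : J -> {RV P >-> R}).
Hypothesis Z_iid : std_gaussian_iid Z.

(** Indices outside [p] receive the whole line as constraint, which has probability one. *)
Lemma iid_bigcap (p : pred J) (B : J -> set R) : (forall j, measurable (B j)) ->
  P (\bigcap_(j in [set j | p j]) (Z j @^-1` B j)) =
  (\prod_(j | p j) normal_prob 0%R 1 (B j))%E.
Proof.
move=> mB; have [Z1 Zindep] := Z_iid.
pose B' j := if p j then B j else setT.
have mB' j : measurable (B' j) by rewrite /B'; case: ifP.
transitivity (P (\bigcap_(j in [set: J]) (Z j @^-1` B' j))).
  congr (P _); apply/seteqP; split => [w H j _|w H j /= pj].
    by rewrite /B'; case: ifPn => // pj; exact: H.
  by have := H j I; rewrite /B' pj.
rewrite Zindep// [RHS]big_mkcond/=; apply: eq_bigr => j _.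
rewrite /B'; case: ifPn => _; first by rewrite Z1.
by rewrite preimage_setT probability_setT.
Qed.

(** Induction on [s]: each step moves one variable from the constraints into the sum by
    [normal_sum_indep]. Carrying arbitrary constraints on the remaining variables is what makes the
    induction hypothesis strong enough. *)
Lemma iid_sum_bigcap (s : seq J) (C : set R) (B : J -> set R) :
  uniq s -> s != [::] -> measurable C -> (forall j, measurable (B j)) ->
  P ((fun w => \sum_(j <- s) Z j w) @^-1` C `&`
     \bigcap_(j in [set j | j \notin s]) (Z j @^-1` B j)) =
  (normal_prob 0%R (Num.sqrt (size s)%:R) C *
   \prod_(j | j \notin s) normal_prob 0%R 1 (B j))%E.
Proof.
elim: s C B => // i s IH C B /=/andP[iNs us] _ mC mB.
have mI (p : pred J) (B' : J -> set R) : (forall j, measurable (B' j)) ->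
    measurable (\bigcap_(j in [set j | p j]) (Z j @^-1` B' j)).
  move=> mB'; apply: fin_bigcap_measurable; first exact: finite_finset.
  move=> j _; rewrite -[X in measurable X]setTI; exact: measurable_funP (mB' j).
pose E := \bigcap_(j in [set j | j \notin i :: s]) (Z j @^-1` B j).
have PE : P E = (\prod_(j | j \notin i :: s) normal_prob 0%R 1 (B j))%E by exact: iid_bigcap.
(* The constraints [B] with the one on the new variable i replaced by [A]. *)
pose upd (A : set R) j := if j == i then A else B j.
have mupd A : measurable A -> forall j, measurable (upd A j).
  by move=> mA j; rewrite /upd; case: ifP.
have prod_upd (p : pred J) A : p i -> (forall j, p j && (j != i) = (j \notin i :: s)) ->
    (\prod_(j | p j) normal_prob 0%R 1 (upd A j))%E = (normal_prob 0%R 1 A * P E)%E.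
  move=> pi pE; rewrite (bigD1 i)//= {1}/upd eqxx PE; congr (_ * _)%E.
  by apply: eq_big => j; [exact: pE|rewrite /upd => /andP[_ /negbTE ->]].
rewrite -PE.
(* The base case is a single variable, where the event on the sum is itself a constraint on that
   variable; an empty sum would have deviation zero. *)
have [s0|sN0] := eqVneq s [::].
  rewrite s0 sqrtr1 -(prod_upd xpredT C)//; last by move=> j; rewrite s0 inE.
  rewrite -iid_bigcap; last exact: mupd.
  congr (P _); apply/seteqP; split => [w [/=] | w H].
    rewrite big_seq1 => Cw H j _ /=; rewrite /upd; case: eqVneq => [->//|ji].
    by apply: H; rewrite /= inE.
  split => /=; first by rewrite big_seq1; have /= := H i isT; rewrite /upd eqxx.
  by move=> j /=; rewrite inE => /negbTE ji; have /= := H j isT; rewrite /upd ji.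
have -> : (fun w => \sum_(j <- i :: s) Z j w) = (fun w => \sum_(j <- s) Z j w) \+ Z i.
  by apply/funext => w; rewrite big_cons addrC.
have sz : (0 < size s)%N by rewrite lt0n size_eq0.
apply: (@normal_sum_indep _ _ _ (Num.sqrt (size s)%:R) 1) => //.
- by rewrite sqrtr_eq0 -ltNge ltr0n.
- by rewrite !sqr_sqrtr ?ler0n// expr1n -natr1.
- exact: measurable_sum.
- exact: mI.
move=> A A' mA mA'.
(* The independence required is the induction hypothesis for [s], with the event on Z i counted
   among the constraints. *)
rewrite -muleA -(prod_upd (fun j => j \notin s))//; last first.
  by move=> j; rewrite inE negb_or andbC.
rewrite -(IH A)//; last exact: mupd.
congr (P _); rewrite -setIA; congr (_ `&` _); apply/seteqP; split => [w [/= Zi H] j /= js|w H].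
  rewrite /upd; case: eqVneq => [->//|ji].
  by apply: H; rewrite /= inE negb_or ji.
split => /=; first by have := H i iNs; rewrite /= /upd eqxx.
move=> j /=; rewrite inE negb_or => /andP[/negbTE ji js].
by have := H j js; rewrite /= /upd ji.
Qed.

Lemma iid_sum_normal (A : {pred J}) (C : set R) : (0 < #|A|)%N -> measurable C ->
  P ((fun w => \sum_(j in A) Z j w) @^-1` C) = normal_prob 0%R (Num.sqrt #|A|%:R) C.
Proof.
move=> A0 mC.
have := @iid_sum_bigcap (enum A) C (fun=> setT) (enum_uniq A).
rewrite -size_eq0 -cardE -lt0n => /(_ A0 mC (fun=> measurableT)).
rewrite [X in (_ * X)%E]big1 ?mule1; last by move=> j _; exact: probability_setT.
move=> <-; congr (P _); rewrite -[LHS]setIT; congr (_ `&` _).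
  by apply/seteqP; split => w /=; rewrite big_enum.
by apply/seteqP; split => w.
Qed.

Lemma measurable_iid_sum (A : {pred J}) : measurable_fun setT (fun w => \sum_(j in A) Z j w).
Proof. by under eq_fun do rewrite -big_enum; apply: measurable_sum. Qed.

Lemma iid_sum_right_tail (A : {pred J}) (a : R) : (0 < #|A|)%N -> 0 < a ->
  (P [set w | (a < (\sum_(j in A) Z j w) / Num.sqrt #|A|%:R)%R]
   <= (expR (- (a ^+ 2 / 2)) / a)%:E)%E.
Proof.
move=> A0 a0; have s0 : 0 < Num.sqrt #|A|%:R :> R by rewrite sqrtr_gt0 ltr0n.
apply: le_trans (normal_prob_right_tail s0 a0).
rewrite -iid_sum_normal//; apply: le_measure; rewrite ?inE.
- apply: measurable_bool_set; apply: measurable_fun_ltr => //.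
  by apply: measurable_funM => //; exact: measurable_iid_sum.
- rewrite -[X in measurable X]setTI; exact: measurable_iid_sum.
- by move=> w /=; rewrite in_itv/= andbT ltr_pdivlMr// => /ltW.
Qed.

Lemma iid_sum_left_tail (A : {pred J}) (a : R) : (0 < #|A|)%N -> 0 < a ->
  (P [set w | ((\sum_(j in A) Z j w) / Num.sqrt #|A|%:R <= - a)%R]
   <= (expR (- (a ^+ 2 / 2)) / a)%:E)%E.
Proof.
move=> A0 a0; have s0 : 0 < Num.sqrt #|A|%:R :> R by rewrite sqrtr_gt0 ltr0n.
apply: le_trans (normal_prob_left_tail s0 a0).
rewrite -iid_sum_normal//; apply: le_measure; rewrite ?inE.
- apply: measurable_bool_set; apply: measurable_fun_ler => //.
  by apply: measurable_funM => //; exact: measurable_iid_sum.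
- rewrite -[X in measurable X]setTI; exact: measurable_iid_sum.
- by move=> w /=; rewrite in_itv/= ler_pdivrMr// mulNr.
Qed.

End gaussian_sums.

(** * Risk bounds at a fixed size *)

Lemma measure_bigsetU_le d (T : measurableType d) (R : realType) (mu : {measure set T -> \bar R})
    (I : Type) (r : seq I) (p : pred I) (A : I -> set T) : (forall i, measurable (A i)) ->
  (mu (\big[setU/set0]_(i <- r | p i) A i) <= \sum_(i <- r | p i) mu (A i))%E.
Proof.
move=> mA; elim: r => [|i r IH]; first by rewrite !big_nil measure0.
rewrite !big_cons; case: ifP => // _.
apply: le_trans (leeD2l _ IH); apply: measureU2 => //.
exact: bigsetU_measurable.
Qed.

(** * Counting indices and clusters *)

Section cardinals.
Variables (d : nat) (n : 'I_d -> nat).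

Lemma card_in_cluster (S : tsides n) :
  #|[pred x : tidx n | in_cluster S x]| = (\prod_(i < d) #|S i|)%N.
Proof.
transitivity #|(family (fun i => mem (S i)) : simpl_pred (tidx n))|; first exact: eq_card.
by rewrite card_family foldrE big_image.
Qed.

Lemma card_tidx : #|tidx n| = (\prod_(i < d) n i)%N.
Proof.
rewrite card_dep_ffun foldrE big_image/=.
by apply: eq_bigr => i _; rewrite card_ord.
Qed.

Lemma card_admissible (k : 'I_d -> nat) :
  #|[pred S : tsides n | admissible k S]| = Gcount n k.
Proof.
transitivity #|(family (fun i => [pred A : {set 'I_(n i)} | #|A| == k i]) : simpl_pred (tsides n))|.
  exact: eq_card.
rewrite card_family foldrE big_image /Gcount; apply: eq_bigr => i _ /=.
rewrite -[in RHS](card_ord (n i)) -card_draws.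
by apply: eq_card => A; rewrite !inE.
Qed.

End cardinals.

(** * The two tests as measurable events *)

Section statistics.
Context {R : realType} dT (T : measurableType dT).
Variables (d : nat) (n k : 'I_d -> nat).

Definition scan_stat (Y : tidx n -> R) (S : tsides n) : R :=
  (\sum_(x : tidx n | in_cluster S x) Y x) / Num.sqrt ((\prod_(i < d) k i)%:R).

Definition scan_threshold : R := Num.sqrt (2 * ln (Gcount n k)%:R).

(** The default [-oo] of the maximum never exceeds the threshold, so the maximum passes it exactly
    when some admissible cluster does. *)
Lemma psi_scanE (Y : tidx n -> R) :
  psi_scan k Y = [exists S, admissible k S && (scan_threshold < scan_stat Y S)].
Proof.
rewrite /psi_scan ltNge; apply/idP/existsP.
  move=> /negP H; apply: contrapT => nex; apply: H; apply/bigmax_leP; split => [|S aS].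
    exact: leNye.
  rewrite lee_fin leNgt; apply/negP => lt; apply: nex; exists S.
  by rewrite aS.
move=> [S /andP[aS lt]]; apply/negP => /bigmax_leP[_ /(_ S aS)].
by rewrite lee_fin leNgt lt.
Qed.

(** The finite union gives both measurability and the union bound. *)
Lemma psi_scan_set (Y : tidx n -> T -> R) :
  [set w | psi_scan k (Y ^~ w)] =
  \big[setU/set0]_(S : tsides n | admissible k S)
    [set w | scan_threshold < scan_stat (Y ^~ w) S].
Proof.
rewrite -bigcup_seq_cond; apply/seteqP; split => w /=.
  rewrite psi_scanE => /existsP[S /andP[aS lt]]; exists S => //=.
  by rewrite mem_index_enum aS.
move=> [S /= /andP[_ aS] lt]; rewrite psi_scanE; apply/existsP; exists S.
by rewrite aS.
Qed.

Lemma measurable_cond_sum (J : finType) (p : pred J) (Y : J -> T -> R) :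
  (forall x, measurable_fun setT (Y x)) ->
  measurable_fun setT (fun w => \sum_(x | p x) Y x w).
Proof.
move=> mY; under eq_fun do rewrite big_mkcond/=.
apply: measurable_sum => x; case: (p x) => //; exact: measurable_cst.
Qed.

Lemma measurable_scan_set (Y : tidx n -> T -> R) (S : tsides n) :
  (forall x, measurable_fun setT (Y x)) ->
  measurable [set w | scan_threshold < scan_stat (Y ^~ w) S].
Proof.
move=> mY; apply: measurable_bool_set; apply: measurable_fun_ltr => //.
by apply: measurable_funM => //; exact: measurable_cond_sum.
Qed.

Lemma measurable_psi_scan (Y : tidx n -> T -> R) :
  (forall x, measurable_fun setT (Y x)) -> measurable [set w | psi_scan k (Y ^~ w)].
Proof.
move=> mY; rewrite psi_scan_set; apply: bigsetU_measurable => S _.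
exact: measurable_scan_set.
Qed.

Lemma measurable_psi_sum W (Y : tidx n -> T -> R) :
  (forall x, measurable_fun setT (Y x)) -> measurable [set w | psi_sum W (Y ^~ w)].
Proof.
move=> mY; apply: measurable_bool_set; apply: measurable_fun_ltr => //.
by apply: measurable_funM => //; exact: measurable_cond_sum.
Qed.

Lemma psi_s_set W (Y : tidx n -> T -> R) :
  [set w | psi_s k W (Y ^~ w)] = [set w | psi_sum W (Y ^~ w)] `|` [set w | psi_scan k (Y ^~ w)].
Proof. by apply/seteqP; split => w /=; rewrite /psi_s => /orP. Qed.

Lemma measurable_psi_s W (Y : tidx n -> T -> R) :
  (forall x, measurable_fun setT (Y x)) -> measurable [set w | psi_s k W (Y ^~ w)].
Proof.
move=> mY; rewrite psi_s_set; apply: measurableU; first exact: measurable_psi_sum.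
exact: measurable_psi_scan.
Qed.

Lemma measurable_psi_sN W (Y : tidx n -> T -> R) :
  (forall x, measurable_fun setT (Y x)) -> measurable [set w | ~~ psi_s k W (Y ^~ w)].
Proof.
move=> mY.
have -> : [set w | ~~ psi_s k W (Y ^~ w)] = ~` [set w | psi_s k W (Y ^~ w)].
  by apply/seteqP; split => w /= /negP.
exact/measurableC/measurable_psi_s.
Qed.

End statistics.

(** * Type I and type II errors *)

Section risk_bounds.
Context {R : realType} dT (T : measurableType dT) (P : probability T R).
Variables (d : nat) (n k : 'I_d -> nat) (Z : tidx n -> {RV P >-> R}).
Hypothesis Z_iid : std_gaussian_iid Z.
Hypotheses (k_gt0 : forall i, (0 < k i)%N) (k_le : forall i, (k i <= n i)%N).

Let K := (\prod_(i < d) k i)%N.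
Let N := (\prod_(i < d) n i)%N.
Let g : R := @scan_threshold R d n k.

Let K_gt0 : (0 < K)%N. Proof. by rewrite prodn_gt0. Qed.
Let N_gt0 : (0 < N)%N.
Proof. by rewrite prodn_gt0// => i; exact: leq_trans (k_gt0 i) (k_le i). Qed.

Lemma card_admissible_cluster S : admissible k S -> #|[pred x : tidx n | in_cluster S x]| = K.
Proof.
move=> /forallP aS; rewrite card_in_cluster; apply: eq_bigr => i _.
exact/eqP.
Qed.

Lemma expR_tail_le (a : R) : 0 < a -> expR (- (a ^+ 2 / 2)) / a <= a^-1.
Proof.
move=> a0; apply: ler_piMl; first by rewrite invr_ge0 ltW.
rewrite -expR0 ler_expR oppr_le0.
by rewrite divr_ge0// sqr_ge0.
Qed.

Lemma psi_sum_type1 W : 0 < W -> (P [set w | psi_sum W (Z ^~ w)] <= W^-1%:E)%E.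
Proof.
move=> W0; have := @iid_sum_right_tail _ _ _ P _ Z Z_iid predT W.
rewrite card_tidx => /(_ N_gt0 W0) H.
apply: (le_trans H); rewrite lee_fin; exact: expR_tail_le.
Qed.

Lemma psi_scan_type1 : (1 < Gcount n k)%N -> (P [set w | psi_scan k (Z ^~ w)] <= g^-1%:E)%E.
Proof.
move=> G1.
have lnG : 0 < ln (Gcount n k)%:R :> R by rewrite ln_gt0// ltr1n.
have g0 : 0 < g by rewrite sqrtr_gt0 mulr_gt0.
have G0 : 0 < (Gcount n k)%:R :> R by rewrite ltr0n ltnW.
(* The threshold is calibrated so that each of the G clusters contributes at most 1 / (G g). *)
have gE : expR (- (g ^+ 2 / 2)) = (Gcount n k)%:R^-1.
  by rewrite sqr_sqrtr ?mulr_ge0 ?ltW// mulrC mulKf// expRN lnK.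
rewrite psi_scan_set; apply: (le_trans (measure_bigsetU_le _ _ _ _)).
  by move=> S; exact: measurable_scan_set.
apply: (@le_trans _ _ (\sum_(S : tsides n | admissible k S) (expR (- (g ^+ 2 / 2)) / g)%:E)%E).
  apply: lee_sum => S aS.
  have := @iid_sum_right_tail _ _ _ P _ Z Z_iid [pred x | in_cluster S x] g.
  by rewrite card_admissible_cluster// => /(_ K_gt0 g0).
rewrite sumEFin lee_fin sumr_const card_admissible -[leLHS]mulr_natl gE mulrA divff ?mul1r//.
by rewrite gt_eqF.
Qed.

Lemma psi_s_type1 W : 0 < W -> (1 < Gcount n k)%N ->
  (P [set w | psi_s k W (Z ^~ w)] <= (W^-1 + g^-1)%:E)%E.
Proof.
move=> W0 G1; rewrite psi_s_set EFinD.
apply: (@le_trans _ _ (P [set w | psi_sum W (Z ^~ w)] + P [set w | psi_scan k (Z ^~ w)])%E).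
  by apply: measureU2; [exact: measurable_psi_sum|exact: measurable_psi_scan].
by apply: leeD; [exact: psi_sum_type1|exact: psi_scan_type1].
Qed.

(** If [psi_s] accepts, so does the sum test. Its statistic is shifted by lam K / sqrt N, so the
    normalised noise must lie at or below -a, where a is the gap between shift and threshold. *)
Lemma psi_s_type2_sum (W lam : R) (S : tsides n) : admissible k S -> W < lam * K%:R / Num.sqrt N%:R ->
  (P [set w | ~~ psi_s k W (fun x => cluster_tensor lam S x + Z x w)%R]
   <= ((lam * K%:R / Num.sqrt N%:R - W)^-1)%:E)%E.
Proof.
move=> aS; rewrite -subr_gt0; set a := _ - W => a0.
apply: (@le_trans _ _ ((expR (- (a ^+ 2 / 2)) / a)%:E)); last first.
  by rewrite lee_fin; exact: expR_tail_le.
have := @iid_sum_left_tail _ _ _ P _ Z Z_iid predT a.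
rewrite card_tidx => /(_ N_gt0 a0); apply: le_trans.
apply: le_measure; rewrite ?inE.
- apply: measurable_psi_sN => x; exact: measurable_funD.
- apply: measurable_bool_set; apply: measurable_fun_ler => //.
  by apply: measurable_funM => //; exact: measurable_cond_sum.
move=> w /=; rewrite negb_or => /andP[+ _]; rewrite /psi_sum -leNgt big_split/=.
rewrite -big_mkcond/= sumr_const (card_admissible_cluster aS) -[lam *+ _]mulr_natr.
rewrite mulrDl opprB lerBrDl; exact.
Qed.

(** If [psi_s] accepts, the scan statistic of the true cluster [S] stays below the threshold
    although it is shifted by lam K / sqrt K = lam sqrt K. *)
Lemma psi_s_type2_scan (W lam : R) (S : tsides n) : admissible k S -> g < lam * Num.sqrt K%:R ->
  (P [set w | ~~ psi_s k W (fun x => cluster_tensor lam S x + Z x w)%R]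
   <= ((lam * Num.sqrt K%:R - g)^-1)%:E)%E.
Proof.
move=> aS; rewrite -subr_gt0; set a := _ - g => a0.
apply: (@le_trans _ _ ((expR (- (a ^+ 2 / 2)) / a)%:E)); last first.
  by rewrite lee_fin; exact: expR_tail_le.
have := @iid_sum_left_tail _ _ _ P _ Z Z_iid [pred x | in_cluster S x] a.
rewrite card_admissible_cluster// => /(_ K_gt0 a0); apply: le_trans.
apply: le_measure; rewrite ?inE.
- apply: measurable_psi_sN => x; exact: measurable_funD.
- apply: measurable_bool_set; apply: measurable_fun_ler => //.
  by apply: measurable_funM => //; exact: measurable_cond_sum.
move=> w /=; rewrite negb_or => /andP[_]; rewrite psi_scanE => /existsPn/(_ S).
rewrite aS/= -leNgt /scan_stat big_split/=.
under eq_bigr => x xS do rewrite /cluster_tensor xS.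
rewrite sumr_const (card_admissible_cluster aS) -[lam *+ _]mulr_natr mulrDl opprB lerBrDl.
suff -> : lam * K%:R / Num.sqrt K%:R = lam * Num.sqrt K%:R by [].
rewrite -mulrA; congr (_ * _).
by rewrite -{1}(@sqr_sqrtr _ K%:R)// expr2 mulfK// sqrtr_eq0 -ltNge ltr0n.
Qed.

Lemma risk_le (W lam q : R) : 0 < W -> (1 < Gcount n k)%N ->
  (forall (lam' : R) (S : tsides n), (lam <= lam')%R -> admissible k S ->
    P [set w | ~~ psi_s k W (fun x => cluster_tensor lam' S x + Z x w)%R] <= q%:E)%E ->
  (risk k lam W Z <= (W^-1 + g^-1 + q)%:E)%E.
Proof.
move=> W0 G1 H; rewrite /risk EFinD; apply: leeD; first exact: psi_s_type1.
by apply: ge_ereal_sup => _ /= [lam' [S [ll aS ->]]]; exact: H.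
Qed.

(** The type II bound decreases as the signal grows, so its value at [lam] bounds the supremum over
    lam' >= lam. *)
Lemma risk_le_sum (W lam : R) : 0 < W -> (1 < Gcount n k)%N -> W < lam * K%:R / Num.sqrt N%:R ->
  (risk k lam W Z <= (W^-1 + g^-1 + (lam * K%:R / Num.sqrt N%:R - W)^-1)%:E)%E.
Proof.
move=> W0 G1 Wl; apply: risk_le => // lam' S ll aS.
have le : lam * K%:R / Num.sqrt N%:R <= lam' * K%:R / Num.sqrt N%:R.
  by rewrite ler_wpM2r ?invr_ge0 ?sqrtr_ge0// ler_wpM2r.
apply: (le_trans (psi_s_type2_sum aS _)); first exact: lt_le_trans le.
rewrite lee_fin lef_pV2 ?posrE ?subr_gt0//; last exact: lt_le_trans le.
by rewrite lerD2r.
Qed.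

Lemma risk_le_scan (W lam : R) : 0 < W -> (1 < Gcount n k)%N -> g < lam * Num.sqrt K%:R ->
  (risk k lam W Z <= (W^-1 + g^-1 + (lam * Num.sqrt K%:R - g)^-1)%:E)%E.
Proof.
move=> W0 G1 Wl; apply: risk_le => // lam' S ll aS.
have le : lam * Num.sqrt K%:R <= lam' * Num.sqrt K%:R by rewrite ler_wpM2r ?sqrtr_ge0.
apply: (le_trans (psi_s_type2_scan _ aS _)); first exact: lt_le_trans le.
rewrite lee_fin lef_pV2 ?posrE ?subr_gt0//; last exact: lt_le_trans le.
by rewrite lerD2r.
Qed.

Lemma exists_admissible : exists S : tsides n, admissible k S.
Proof.
have : (0 < #|[pred S : tsides n | admissible k S]|)%N.
  rewrite card_admissible prodn_gt0// => i.
  by rewrite bin_gt0.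
by move=> /card_gt0P[S]; rewrite inE => aS; exists S.
Qed.

(** A supremum over an empty family would be [-oo]; an admissible cluster provides a nonnegative
    member. *)
Lemma risk_ge0 (W lam : R) : (0 <= risk k lam W Z)%E.
Proof.
rewrite /risk adde_ge0//; have [S aS] := exists_admissible.
apply: (@le_trans _ _ (P [set w | ~~ psi_s k W (fun x => (cluster_tensor lam S x + Z x w)%R)])).
  exact: measure_ge0.
by apply: ereal_sup_ubound; exists lam, S.
Qed.

End risk_bounds.

(** * Asymptotics *)

(** In Pascal's rule one term is at least n by induction and the other at least 1; the boundary
    case, where the induction hypothesis fails, is computed directly. *)
Lemma leq_bin n k : (0 < k < n)%N -> (n <= 'C(n, k))%N.
Proof.
elim: n k => // n IH [|k]//= kn; rewrite binS.
have [kn'|nk] := ltnP k.+1 n.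
  rewrite -addn1; apply: leq_add; first exact: IH.
  by rewrite bin_gt0 ltnW// ltnW.
have -> : n = k.+1 by apply/eqP; rewrite eqn_leq nk -ltnS kn.
by rewrite binn binSn add1n.
Qed.

(** The other binomials are at least 1. This lower bound drives the scan threshold to infinity. *)
Lemma leq_Gcount d (n k : 'I_d -> nat) (i0 : 'I_d) :
  (forall i, (0 < k i < n i)%N) -> (n i0 <= Gcount n k)%N.
Proof.
move=> kn; rewrite /Gcount (bigD1 i0)//= -[leqLHS]muln1.
apply: leq_mul; first exact: leq_bin.
rewrite prodn_gt0// => i; rewrite bin_gt0.
by have /andP[_ /ltnW] := kn i.
Qed.

Lemma ffact_leq_exp n k : (n ^_ k <= n ^ k)%N.
Proof.
elim: k n => // k IH [|n]; first by rewrite ffactE.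
rewrite ffactSS expnS leq_mul//; apply: (leq_trans (IH n)).
by case: k {IH} => // k; rewrite leq_exp2r.
Qed.

Section asymptotics.
Context {R : realType}.

(** C(n,k) <= n^k / k! = (n/k)^k (k^k / k!), and k^k / k! is one term of the series of exp(k). *)
Lemma bin_le_expR n k : (0 < k)%N -> (0 < n)%N ->
  'C(n, k)%:R <= expR (k%:R * ln (n%:R / k%:R) + k%:R) :> R.
Proof.
move=> k0 n0.
have kR : 0 < k%:R :> R by rewrite ltr0n.
have nR : 0 < n%:R :> R by rewrite ltr0n.
have kf0 : 0 < k`!%:R :> R by rewrite ltr0n fact_gt0.
rewrite expRD expRM_natl lnK ?posrE ?divr_gt0//.
have kk : k%:R ^+ k / k`!%:R <= expR k%:R :> R.
  case: k k0 kR {kf0} => // k _ kR; apply: le_trans (expR_ge1Dxn k (ltW kR)).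
  by rewrite lerDr.
apply: (@le_trans _ _ (n%:R ^+ k / k`!%:R)).
  rewrite ler_pdivlMr// -natrM bin_ffact -natrX ler_nat.
  exact: ffact_leq_exp.
have -> : n%:R ^+ k / k`!%:R = (n%:R / k%:R) ^+ k * (k%:R ^+ k / k`!%:R) :> R.
  by rewrite expr_div_n mulrA mulfVK// expf_neq0// gt_eqF.
by rewrite ler_wpM2l// exprn_ge0// divr_ge0// ltW.
Qed.

Lemma ln_Gcount_le d (n k : 'I_d -> nat) : (forall i, (0 < k i <= n i)%N) ->
  ln (Gcount n k)%:R <= \sum_(i < d) ((k i)%:R * ln ((n i)%:R / (k i)%:R) + (k i)%:R) :> R.
Proof.
move=> kn; rewrite -[leRHS]expRK ler_ln ?posrE ?expR_gt0//; last first.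
  by rewrite ltr0n prodn_gt0// => i; rewrite bin_gt0; have /andP[] := kn i.
rewrite /Gcount natr_prod expR_sum; apply: ler_prod => i _.
have /andP[k0 kle] := kn i.
by rewrite ler0n bin_le_expR// (leq_trans k0).
Qed.

Lemma cvgy_ln (u : nat -> R) : u @ \oo --> +oo -> (fun t => ln (u t)) @ \oo --> +oo.
Proof.
move=> /cvgryPge uy; apply/cvgryPge => A.
near=> t; have H : expR A <= u t by near: t; exact: uy.
by rewrite -[leLHS]expRK ler_ln// posrE ?(lt_le_trans _ H) ?expR_gt0.
Unshelve. all: by end_near. Qed.

Lemma cvgy_sqrt (u : nat -> R) : u @ \oo --> +oo -> (fun t => Num.sqrt (u t)) @ \oo --> +oo.
Proof.
move=> /cvgryPge uy; apply/cvgryPge => A.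
near=> t; have H : A ^+ 2 <= u t by near: t; exact: uy.
by rewrite (le_trans (ler_norm A))// -sqrtr_sqr ler_wsqrtr.
Unshelve. all: by end_near. Qed.

Lemma ger_cvgy (u v : nat -> R) : u @ \oo --> +oo -> (\forall t \near \oo, u t <= v t) ->
  v @ \oo --> +oo.
Proof.
move=> /cvgryPge uy uv; apply/cvgryPge => A.
by apply: filterS2 uv (uy A) => t uvt Au; exact: le_trans uvt.
Qed.

Lemma cvgy_gt (c : R) (u : nat -> R) : u @ \oo --> +oo -> \forall t \near \oo, c < u t.
Proof. by move=> /cvgryPgt uy; exact: uy. Qed.

Lemma cvgy_mull (c : R) (u : nat -> R) : 0 < c -> u @ \oo --> +oo ->
  (fun t => c * u t) @ \oo --> +oo.
Proof.
move=> c0 /cvgryPge uy; apply/cvgryPge => A.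
by apply: filterS (uy (A / c)) => t; rewrite ler_pdivrMr// mulrC.
Qed.

(** Eventually u exceeds (a/2) L. With L = log n, a positive limiting exponent becomes
    divergence. *)
Lemma cvgy_div (u L : nat -> R) (a : R) : 0 < a -> L @ \oo --> +oo ->
  (fun t => u t / L t) @ \oo --> a -> u @ \oo --> +oo.
Proof.
move=> a0 Ly uL.
have a20 : 0 < a / 2 by rewrite divr_gt0.
have H : (fun t => a / 2 * L t) @ \oo --> +oo by exact: cvgy_mull.
apply: (ger_cvgy H); near=> t.
have L0 : 0 < L t by near: t; exact: cvgy_gt.
have : a / 2 < u t / L t by near: t; apply: (cvgr_gt _ uL); lra.
by rewrite ltr_pdivlMr// => /ltW.
Unshelve. all: by end_near. Qed.

(** The liminf is the supremum of the tail infima, so one of them already exceeds 1 and serves as a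
    fixed margin c. *)
Lemma limn_einf_gt (u : nat -> R) : (1 < limn_einf (EFin \o u))%E ->
  exists2 c : R, 1 < c & \forall t \near \oo, c <= u t.
Proof.
rewrite limn_einf_lim.
have /cvg_lim -> // := ereal_nondecreasing_cvgn (nondecreasing_einfs (EFin \o u)).
move=> /ereal_sup_gt[_ [m _ <-]] lt1.
have [c c1 ce] : exists2 c : R, 1 < c & (c%:E <= einfs (EFin \o u) m)%E.
  move: lt1; case: (einfs _ m) => [r|_|//]; first by rewrite lte_fin; exists r.
  (* If the tail infimum is infinite, any real above 1 will do. *)
  by exists 2; rewrite ?leey// ltr1n.
exists c => //; exists m => // t /= mt.
rewrite -lee_fin; apply: (le_trans ce); apply: ereal_inf_lbound.
by exists t.
Qed.

End asymptotics.

(** * Vanishing risk from diverging gaps *)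

Section risk_limits.
Context {R : realType} dT (T : measurableType dT) (P : probability T R).
Variables (d : nat) (i0 : 'I_d) (n k : nat -> 'I_d -> nat) (lam W : nat -> R).
Variable Z : forall t, tidx (n t) -> {RV P >-> R}.
Hypothesis Z_iid : forall t, std_gaussian_iid (@Z t).
Hypothesis kn : \forall t \near \oo, forall i, (0 < k t i < n t i)%N.
Hypothesis ln_n : (fun t => ln (n t i0)%:R : R) @ \oo --> +oo.

Let g t : R := scan_threshold (n t) (k t).
Let signal_sum t : R := lam t * (\prod_(i < d) k t i)%:R / Num.sqrt ((\prod_(i < d) n t i)%:R).
Let signal_scan t : R := lam t * Num.sqrt ((\prod_(i < d) k t i)%:R).

Lemma scan_threshold_cvgy : g @ \oo --> +oo.
Proof.
apply: cvgy_sqrt; apply: cvgy_mull => //.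
apply: (ger_cvgy ln_n); near=> t.
have knt : forall i, (0 < k t i < n t i)%N by near: t.
have le := leq_Gcount i0 knt.
have n0 : (0 < n t i0)%N by have /andP[_] := knt i0; exact: leq_ltn_trans.
by rewrite ler_ln ?posrE ?ltr0n ?ler_nat// (leq_trans n0).
Unshelve. all: by end_near. Qed.

Lemma Gcount_gt1_near : \forall t \near \oo, (1 < Gcount (n t) (k t))%N.
Proof.
near=> t; have knt : forall i, (0 < k t i < n t i)%N by near: t.
apply: leq_trans (leq_Gcount i0 knt).
by have /andP[k0 kn0] := knt i0; exact: leq_ltn_trans kn0.
Unshelve. all: by end_near. Qed.

Lemma risk_cvg0 (r : nat -> R) : W @ \oo --> +oo -> r @ \oo --> +oo ->
  (\forall t \near \oo, (risk (k t) (lam t) (W t) (@Z t)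
      <= ((W t)^-1 + (g t)^-1 + (r t)^-1)%:E)%E) ->
  (fun t => risk (k t) (lam t) (W t) (@Z t)) @ \oo --> 0%E.
Proof.
move=> Wy ry le.
apply: (@squeeze_cvge _ _ _ _ (fun=> 0%E) _ (fun t => ((W t)^-1 + (g t)^-1 + (r t)^-1)%:E)).
- near=> t; have knt : forall i, (0 < k t i < n t i)%N by near: t.
  apply/andP; split; last by near: t.
  by apply: risk_ge0 => i; have /andP[k0 /ltnW] := knt i.
- exact: cvg_cst.
have inv0 (u : nat -> R) : u @ \oo --> +oo -> (fun t => (u t)^-1) @ \oo --> 0.
  by move=> uy; apply/gtr0_cvgV0 => //; exact: cvgy_gt.
apply: cvg_EFin; first by near=> t.
rewrite -[X in _ --> X]addr0 -[X in _ --> X + _]addr0.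
by apply: cvgD; [apply: cvgD|]; apply: inv0 => //; exact: scan_threshold_cvgy.
Unshelve. all: by end_near. Qed.

Lemma risk_cvg0_sum : W @ \oo --> +oo -> (fun t => signal_sum t - W t) @ \oo --> +oo ->
  (fun t => risk (k t) (lam t) (W t) (@Z t)) @ \oo --> 0%E.
Proof.
move=> Wy ry; apply: (risk_cvg0 Wy ry); near=> t.
have knt : forall i, (0 < k t i < n t i)%N by near: t.
apply: risk_le_sum => //.
- by move=> i; have /andP[] := knt i.
- by move=> i; have /andP[_ /ltnW] := knt i.
- by near: t; exact: cvgy_gt.
- by near: t; exact: Gcount_gt1_near.
- by rewrite -subr_gt0; near: t; exact: cvgy_gt.
Unshelve. all: by end_near. Qed.

Lemma risk_cvg0_scan : W @ \oo --> +oo -> (fun t => signal_scan t - g t) @ \oo --> +oo ->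
  (fun t => risk (k t) (lam t) (W t) (@Z t)) @ \oo --> 0%E.
Proof.
move=> Wy ry; apply: (risk_cvg0 Wy ry); near=> t.
have knt : forall i, (0 < k t i < n t i)%N by near: t.
apply: risk_le_scan => //.
- by move=> i; have /andP[] := knt i.
- by move=> i; have /andP[_ /ltnW] := knt i.
- by near: t; exact: cvgy_gt.
- by near: t; exact: Gcount_gt1_near.
- by rewrite -subr_gt0; near: t; exact: cvgy_gt.
Unshelve. all: by end_near. Qed.

End risk_limits.

(** * The scan gap in regime (A1) *)

Section regimes.
Context {R : realType}.

(** With D = sum k_i log(n_i/k_i), the signal is eventually at least c sqrt(2D) for some c > 1.
    Since n_i/k_i diverges, log G <= D + sum k_i <= c D eventually, so the gap is at least (c - sqrt
    c) sqrt(2D). *)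
Lemma scan_gap_A1 d (i0 : 'I_d) (n k : nat -> 'I_d -> nat) (lam : nat -> R) :
  (\forall t \near \oo, forall i, (0 < k t i < n t i)%N) ->
  (fun t => ((k t i0)%:R : R)) @ \oo --> +oo ->
  (forall i, (fun t => ((k t i)%:R / (n t i)%:R : R)) @ \oo --> 0) ->
  (1 < limn_einf (fun t =>
      (lam t * Num.sqrt ((\prod_(i < d) k t i)%:R)
       / Num.sqrt (2 * \sum_(i < d) (k t i)%:R * ln ((n t i)%:R / (k t i)%:R)))%:E))%E ->
  (fun t => lam t * Num.sqrt ((\prod_(i < d) k t i)%:R) - scan_threshold (n t) (k t))
    @ \oo --> +oo.
Proof.
move=> kn ky kn0 /limn_einf_gt[c c1 cle].
pose D t : R := \sum_(i < d) (k t i)%:R * ln ((n t i)%:R / (k t i)%:R).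
have c0 : 0 < c by lra.
(* The bound 1 gives D >= k_{i0}, hence D diverges; the bound 1/(c-1) gives k_i <= (c-1) k_i
   log(n_i/k_i), which absorbs the linear terms. *)
pose M := Num.max 1 (c - 1)^-1.
have lnM : \forall t \near \oo, forall i, M <= ln ((n t i)%:R / (k t i)%:R).
  apply: filter_forall => i.
  near=> t; have knt : forall i, (0 < k t i < n t i)%N by near: t.
  have /andP[k0 kni] := knt i.
  have kR : 0 < (k t i)%:R :> R by rewrite ltr0n.
  have nR : 0 < (n t i)%:R :> R by rewrite ltr0n (leq_trans _ kni).
  rewrite -[leLHS]expRK ler_ln ?posrE ?expR_gt0 ?divr_gt0//.
  rewrite -[leRHS]invrK invf_div -[leLHS]invrK lef_pV2 ?posrE ?invr_gt0 ?expR_gt0 ?divr_gt0//.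
  by near: t; apply: (cvgr_le _ (kn0 i)); rewrite invr_gt0 expR_gt0.
have kD : \forall t \near \oo, (k t i0)%:R <= D t.
  near=> t.
  have lnMt : forall i, M <= ln ((n t i)%:R / (k t i)%:R) by near: t.
  have ln1 i : 1 <= ln ((n t i)%:R / (k t i)%:R) :> R.
    by apply: le_trans (lnMt i); rewrite le_max lexx.
  rewrite /D (bigD1 i0)//= -[leLHS]addr0 lerD//.
    by rewrite ler_peMr.
  by apply: sumr_ge0 => i _; rewrite mulr_ge0// (le_trans _ (ln1 i)).
have Dy : D @ \oo --> +oo by exact: ger_cvgy ky kD.
have sc : 0 < c - Num.sqrt c.
  rewrite subr_gt0 -[ltRHS]ger0_norm ?ltW// -sqrtr_sqr ltr_sqrt ?exprn_gt0//.
  by rewrite expr2 ltr_pMl.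
have H : (fun t => (c - Num.sqrt c) * Num.sqrt (2 * D t)) @ \oo --> +oo.
  by apply: cvgy_mull => //; apply: cvgy_sqrt; exact: cvgy_mull.
apply: (ger_cvgy H); near=> t.
have D0 : 0 < D t by near: t; exact: cvgy_gt.
have knt : forall i, (0 < k t i < n t i)%N by near: t.
have lnMt : forall i, M <= ln ((n t i)%:R / (k t i)%:R) by near: t.
rewrite mulrBl; apply: lerB.
  rewrite -ler_pdivlMr ?sqrtr_gt0 ?mulr_gt0//.
  by near: t.
rewrite /scan_threshold -sqrtrM ?(ltW c0)// ler_wsqrtr// mulrCA ler_wpM2l//.
apply: (le_trans (ln_Gcount_le _)).
  by move=> i; have /andP[-> /ltnW] := knt i.
rewrite mulr_sumr; apply: ler_sum => i _.
have : (c - 1)^-1 <= ln ((n t i)%:R / (k t i)%:R).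
  by apply: le_trans (lnMt i); rewrite le_max lexx orbT.
rewrite -[leLHS]mul1r ler_pdivrMr ?subr_gt0// => H1.
have := ler_wpM2l (ler0n R (k t i)) H1; lra.
Unshelve. all: by end_near. Qed.

End regimes.

(** * Regime (A2) *)

Section regime_A2.
Context {R : realType}.

Lemma ln_prodn d (m : 'I_d -> nat) : (forall i, (0 < m i)%N) ->
  ln (\prod_(i < d) m i)%:R = \sum_(i < d) ln (m i)%:R :> R.
Proof.
move=> m0; rewrite -[RHS]expRK expR_sum natr_prod; congr (ln _).
by apply: eq_bigr => i _; rewrite lnK// posrE ltr0n.
Qed.

Lemma ln_sqrt (x : R) : 0 < x -> ln (Num.sqrt x) = ln x / 2.
Proof.
move=> x0; rewrite -[in RHS](sqr_sqrtr (ltW x0)) lnXn ?sqrtr_gt0//.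
by field.
Qed.

Lemma cvg_sum_ord d (f : 'I_d -> nat -> R) (a : 'I_d -> R) :
  (forall i, f i @ \oo --> a i) -> (fun t => \sum_(i < d) f i t) @ \oo --> \sum_(i < d) a i.
Proof. by move=> fa; apply: cvg_big => //; exact: add_continuous. Qed.

Lemma cvgy_of_ln (x : nat -> R) : (forall t, 0 < x t) -> (fun t => ln (x t)) @ \oo --> +oo ->
  x @ \oo --> +oo.
Proof.
move=> x0 lny; apply: (ger_cvgy lny); near=> t.
by apply/ltW/ln_sublinear.
Unshelve. all: by end_near. Qed.

Variables (d : nat) (i0 : 'I_d) (nn : nat -> nat) (n : nat -> 'I_d -> nat) (kk : nat -> nat).
Variables (lam : nat -> R) (alpha beta : R).
Hypothesis nny : (fun t => (nn t)%:R : R) @ \oo --> +oo.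
Hypothesis n_nn : forall i, (fun t => ln (n t i)%:R / ln (nn t)%:R) @ \oo --> (1 : R).
Hypothesis kn : forall t i, (1 <= kk t < n t i)%N.
Hypothesis k_alpha : (fun t => ln (kk t)%:R / ln (nn t)%:R) @ \oo --> alpha.
Hypothesis lam0 : forall t, 0 < lam t.
Hypothesis lam_beta : (fun t => ln (lam t)^-1 / ln (nn t)%:R) @ \oo --> beta.

Let L t : R := ln (nn t)%:R.
Let Ly : L @ \oo --> +oo. Proof. exact: cvgy_ln. Qed.

Let k0 t : (0 < kk t)%N. Proof. by have /andP[] := kn t i0. Qed.
Let n0 t i : (0 < n t i)%N. Proof. by have /andP[_] := kn t i; exact: leq_trans. Qed.

Lemma ln_n_cvgy_A2 : (fun t => ln (n t i0)%:R : R) @ \oo --> +oo.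
Proof. exact: (cvgy_div ltr01 Ly (n_nn i0)). Qed.

(** The logarithm of the signal, divided by log n, tends to -beta + d alpha - d/2 > 0. *)
Lemma signal_sum_cvgy_A2 : beta < d%:R * alpha - d%:R / 2 ->
  (fun t => lam t * (\prod_(i < d) kk t)%:R / Num.sqrt ((\prod_(i < d) n t i)%:R)) @ \oo --> +oo.
Proof.
move=> ltb.
have K0 t : 0 < (\prod_(i < d) kk t)%:R :> R by rewrite ltr0n prodn_gt0.
have N0 t : 0 < (\prod_(i < d) n t i)%:R :> R by rewrite ltr0n prodn_gt0.
apply: cvgy_of_ln => [t|]; first by rewrite divr_gt0 ?mulr_gt0 ?sqrtr_gt0.
have a0 : 0 < - beta + (\sum_(i < d) alpha - (\sum_(i < d) 1) / 2).
  rewrite !sumr_const card_ord -[alpha *+ _]mulr_natl; lra.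
apply: (cvgy_div a0 Ly).
under eq_fun => t.
  rewrite ln_div ?posrE ?mulr_gt0 ?sqrtr_gt0// lnM ?posrE// ln_sqrt// !ln_prodn//.
  have -> : (ln (lam t) + \sum_(i < d) ln (kk t)%:R - (\sum_(i < d) ln (n t i)%:R) / 2) / ln (nn t)%:R
    = - (ln (lam t)^-1 / ln (nn t)%:R) + (\sum_(i < d) (ln (kk t)%:R / ln (nn t)%:R) -
      (\sum_(i < d) (ln (n t i)%:R / ln (nn t)%:R)) / 2).
    by rewrite -!mulr_suml lnV ?posrE//; ring.
  over.
apply: cvgD; first exact: cvgN.
apply: cvgB; first exact: cvg_sum_ord.
by apply: cvgM; [exact: cvg_sum_ord|exact: cvg_cst].
Qed.

(** Here log G is at most of order k log n, so the squared signal lam^2 k^d beats it once lam^2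
    k^(d-1) is a positive power of n. Then the signal is at least 2g and the gap at least g. *)
Lemma scan_gap_A2 : beta < (d%:R - 1) * alpha / 2 ->
  (fun t => lam t * Num.sqrt ((\prod_(i < d) kk t)%:R) -
    scan_threshold (n t) (fun=> kk t)) @ \oo --> +oo.
Proof.
move=> ltb.
pose gam := (d%:R - 1) * alpha - 2 * beta.
have gam0 : 0 < gam by rewrite /gam; lra.
(* The logarithm of lam^2 k^(d-1), the squared signal with the factor k of the bound on log G
   divided out. *)
pose y t : R := 2 * ln (lam t) + (d%:R - 1) * ln (kk t)%:R.
have yL : (fun t => y t / L t) @ \oo --> gam.
  have -> : (fun t => y t / L t) =
      (fun t => (d%:R - 1) * (ln (kk t)%:R / L t) - 2 * (ln (lam t)^-1 / L t)).
    by apply/funext => t; rewrite /y lnV ?posrE//; ring.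
  by apply: cvgB; (apply: cvgM; first exact: cvg_cst).
have gy : (fun t => scan_threshold (n t) (fun=> kk t) : R) @ \oo --> +oo.
  apply: (@scan_threshold_cvgy R d i0 n (fun t _ => kk t)); last exact: ln_n_cvgy_A2.
  by near=> t => i; exact: kn.
have dn : (0 < d)%N by exact: leq_ltn_trans (ltn_ord i0).
have d0 : 0 < d%:R :> R by rewrite ltr0n.
have c0 : 0 < gam / 4 by lra.
apply: (ger_cvgy gy); near=> t.
set g := scan_threshold _ _.
suff : 2 * g <= lam t * Num.sqrt (\prod_(i < d) kk t)%:R by lra.
have L1 : 1 <= L t by apply/ltW; near: t; exact: cvgy_gt.
have kR : 0 < (kk t)%:R :> R by rewrite ltr0n.
have k1 : 0 <= ln (kk t)%:R :> R by rewrite ln_ge0// ler1n.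
(* The 3 is 2 + 1: log(n_i/k) <= log n_i <= 2L eventually, and the extra k is at most k L. *)
have lnG : ln (Gcount (n t) (fun=> kk t))%:R <= 3 * d%:R * (kk t)%:R * L t :> R.
  apply: (le_trans (ln_Gcount_le _)).
    by move=> i; have /andP[-> /ltnW] := kn t i.
  have -> : 3 * d%:R * (kk t)%:R * L t = \sum_(i < d) (kk t)%:R * (3 * L t).
    by rewrite sumr_const card_ord -[RHS]mulr_natl; ring.
  apply: ler_sum => i _; rewrite -[X in _ + X]mulr1 -mulrDr ler_wpM2l//.
  rewrite ln_div ?posrE ?ltr0n//.
  have : ln (n t i)%:R <= 2 * L t; last by lra.
  have H : forall j, ln (n t j)%:R / L t <= 2.
    near: t; apply: filter_forall => j.
    by apply: (cvgr_le _ (n_nn j)); lra.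
  by have := H i; rewrite ler_pdivrMr// (lt_le_trans _ L1).
(* The 24 arises from (2g)^2 = 8 log G and the factor 3 above. Of y >= (gam/2) L, one half dominates
   log L up to a constant and the other half dominates the constants. *)
have key : ln (24 * d%:R * L t) <= y t.
  have L0 : 0 < L t by lra.
  have yt : gam / 2 * L t <= y t.
    rewrite -ler_pdivlMr//; near: t; apply: (cvgr_ge _ yL); lra.
  have lnL : ln (L t) <= gam / 4 * L t - ln (gam / 4).
    rewrite lerBrDl -lnM ?posrE//; apply/ltW/ln_sublinear; exact: mulr_gt0.
  have Lbig : ln (24 * d%:R) - ln (gam / 4) <= gam / 4 * L t.
    by apply/ltW; near: t; apply: cvgy_gt; exact: cvgy_mull.
  rewrite lnM ?posrE ?mulr_gt0//; lra.
have g2 : (2 * g) ^+ 2 <= (lam t * Num.sqrt (\prod_(i < d) kk t)%:R) ^+ 2.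
  have G1 : 1 <= (Gcount (n t) (fun=> kk t))%:R :> R.
    by rewrite ler1n prodn_gt0// => i; rewrite bin_gt0; have /andP[_ /ltnW] := kn t i.
  rewrite !exprMn sqr_sqrtr ?mulr_ge0 ?ln_ge0// sqr_sqrtr ?ler0n//.
  apply: (@le_trans _ _ (24 * d%:R * L t * (kk t)%:R)).
    move: lnG; lra.
  rewrite -ler_ln ?posrE ?mulr_gt0 ?exprn_gt0 ?ltr0n ?prodn_gt0//; last by lra.
  rewrite lnM ?posrE ?mulr_gt0//; last by lra.
  rewrite [leRHS]lnM ?posrE ?exprn_gt0 ?ltr0n ?prodn_gt0//.
  rewrite lnXn// ln_prodn// sumr_const card_ord -[ln (kk t)%:R *+ d]mulr_natl.
  move: key; rewrite /y; lra.
by rewrite -ler_sqr ?nnegrE ?mulr_ge0 ?sqrtr_ge0 ?(ltW (lam0 t)).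
Unshelve. all: by end_near. Qed.

End regime_A2.

Lemma A1_near (R : realType) d (n k : nat -> 'I_d -> nat) :
  (forall i, (fun t => ((n t i)%:R : R)) @ \oo --> +oo) ->
  (forall i, (fun t => ((k t i)%:R : R)) @ \oo --> +oo) ->
  (forall i, (fun t => ((k t i)%:R / (n t i)%:R : R)) @ \oo --> 0) ->
  \forall t \near \oo, forall i, (0 < k t i < n t i)%N.
Proof.
move=> ny ky kn0; apply: filter_forall => i; near=> t.
have k0 : 0 < (k t i)%:R :> R by near: t; exact: cvgy_gt.
have n0 : 0 < (n t i)%:R :> R by near: t; exact: cvgy_gt.
rewrite -(ltr0n R) k0 -(ltr_nat R) -[ltRHS]mul1r -ltr_pdivrMr//=.
by near: t; apply: (cvgr_lt _ (kn0 i)).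
Unshelve. all: by end_near. Qed.

Unset Implicit Arguments.

Theorem mainTheorem6 (R : realType) (d : nat) (hd : (0 < d)%N)
    (dT : measure_display) (T : measurableType dT) (P : probability T R) :
  (* Part 1: regime (A1), sufficient conditions (i) or (ii) *)
  (forall (n k : nat -> 'I_d -> nat) (lam W : nat -> R)
      (Z : forall t, tidx (n t) -> {RV P >-> R}),
    (forall t, std_gaussian_iid (Z t)) ->
    (forall i, (fun t => ((n t i)%:R : R)) @ \oo --> +oo) ->
    (forall i, (fun t => ((k t i)%:R : R)) @ \oo --> +oo) ->
    (forall i, (fun t => ((k t i)%:R / (n t i)%:R : R)) @ \oo --> 0) ->
    W @ \oo --> +oo ->
    ((  (fun t => lam t * (\prod_(i < d) k t i)%:R
                    / Num.sqrt ((\prod_(i < d) n t i)%:R)) @ \oo --> +oo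
      /\ exists c : R, 0 < c < 1 /\
           forall t, W t <= c * (lam t * (\prod_(i < d) k t i)%:R
                    / Num.sqrt ((\prod_(i < d) n t i)%:R)))
     \/ (1 < limn_einf (fun t =>
            (lam t * Num.sqrt ((\prod_(i < d) k t i)%:R)
             / Num.sqrt (2 * \sum_(i < d)
                   (k t i)%:R * ln ((n t i)%:R / (k t i)%:R)))%:E))%E) ->
    (fun t => risk (k t) (lam t) (W t) (Z t)) @ \oo --> 0%E)
  /\
  (* Part 2: regime (A2) *)
  (forall (alpha beta : R), 0 <= alpha <= 1 ->
   forall (nn : nat -> nat) (n : nat -> 'I_d -> nat) (kk : nat -> nat)
      (lam : nat -> R) (Z : forall t, tidx (n t) -> {RV P >-> R}),
    (forall t, std_gaussian_iid (Z t)) ->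
    (fun t => ((nn t)%:R : R)) @ \oo --> +oo ->
    (forall i, (fun t => ln ((n t i)%:R : R) / ln (nn t)%:R) @ \oo --> (1 : R)) ->
    (forall t i, (1 <= kk t < n t i)%N) ->
    (fun t => ln ((kk t)%:R : R) / ln (nn t)%:R) @ \oo --> alpha ->
    (forall t, 0 < lam t) ->
    (fun t => ln (lam t)^-1 / ln ((nn t)%:R : R)) @ \oo --> beta ->
    beta < Num.max (d%:R * alpha - d%:R / 2) ((d%:R - 1) * alpha / 2) ->
    exists W : nat -> R,
      (fun t => risk (fun _ => kk t) (lam t) (W t) (Z t)) @ \oo --> 0%E).
Proof.
pose i0 := Ordinal hd.
split.
  move=> n k lam W Z Z_iid ny ky kn0 Wy cases.
  have kn := A1_near ny ky kn0.
  have lnn : (fun t => ln (n t i0)%:R : R) @ \oo --> +oo by exact: cvgy_ln.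
  case: cases => [[ry [c [/andP[c0 c1] Wc]]]|einf].
    apply: (risk_cvg0_sum Z_iid kn lnn Wy).
    have c10 : 0 < 1 - c by rewrite subr_gt0.
    (* From W <= c signal, the gap is at least (1 - c) signal. *)
    apply: (ger_cvgy (cvgy_mull c10 ry)); near=> t.
    by rewrite mulrBl mul1r lerB.
  apply: (risk_cvg0_scan Z_iid kn lnn Wy).
  exact: (scan_gap_A1 kn (ky i0) kn0 einf).
move=> alpha beta _ nn n kk lam Z Z_iid nny n_nn kn k_alpha lam0 lam_beta.
have knear : \forall t \near \oo, forall i, (0 < kk t < n t i)%N.
  by near=> t => i; exact: kn.
have lnn := ln_n_cvgy_A2 i0 nny n_nn.
(* The larger term of the maximum decides which test detects. *)
rewrite lt_max => /orP[lt_sum|lt_scan].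
  have ry := signal_sum_cvgy_A2 i0 nny n_nn kn k_alpha lam0 lam_beta lt_sum.
  have half : 0 < 2^-1 :> R by [].
  have r2y := cvgy_mull half ry.
  (* With W half the signal, the threshold and the gap are equal and both diverge. *)
  exists (fun t => 2^-1 * (lam t * (\prod_(i < d) kk t)%:R
                    / Num.sqrt ((\prod_(i < d) n t i)%:R))).
  apply: (risk_cvg0_sum (k := fun t _ => kk t) Z_iid knear lnn r2y).
  apply: (ger_cvgy r2y); near=> t; lra.
(* The scan test supplies the power, so any W tending to infinity controls the type I error of the
   sum test. *)
exists (fun t => t%:R).
apply: (risk_cvg0_scan (k := fun t _ => kk t) Z_iid knear lnn cvgr_idn).
exact: (scan_gap_A2 i0 nny n_nn kn k_alpha lam0 lam_beta lt_scan).
Unshelve. all: by end_near. Qed.
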